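(* Let $n\geq 1$, let $A=(a_{r,c})_{1\le r,c\le n}$ be an $n\times n$ matrix and let $\lambda_a,\mu_a$ ($a\in\{2-n,\dots,n-2\}$) be parameters, such that the generalized Lambda-determinant $|A|_{\lambda,\mu}$ (defined in the context) is defined (for instance, the entries are indeterminates). Then $$|A|_{\lambda,\mu}=\sum_{B}\ \prod_{i,j=1}^n w_{i,j}(A,B;\lambda,\mu),$$ where the sum runs over all $n\times n$ alternating sign matrices $B=(b_{i,j})$ and $$w_{i,j}(A,B;\lambda,\mu)=(a_{i,j})^{b_{i,j}}\times\begin{cases}\lambda_{j-i}&\text{if } \mathcal C(B)_{i,j}=a_1,\\ \mu_{i+j-n-1}&\text{if } \mathcal C(B)_{i,j}=b_1,\\ \lambda_{j-i}+\mu_{i+j-n-1}&\text{if } \mathcal C(B)_{i,j}=c_2,\\ 1&\text{otherwise.}\end{cases}$$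
   Context: Generalized Lambda-determinant: given $A=(a_{r,c})_{1\le r,c\le n}$ and parameters $(\lambda_a)_{a\in\mathbb Z},(\mu_a)_{a\in\mathbb Z}$, define $T_{i,j,k}$ for $i,j\in\mathbb Z$, $k\ge 0$, $i+j+k\equiv n \pmod 2$, by the initial data $T_{i,j,0}=1$ ($i+j\equiv n$ mod 2), $T_{i,j,1}=a_{\frac{j-i+n+1}{2},\frac{i+j+n+1}{2}}$ ($i+j\equiv n+1$ mod 2, $|i|+|j|\le n-1$), and the recursion $T_{i,j,k+1}T_{i,j,k-1}=\mu_j\,T_{i,j+1,k}T_{i,j-1,k}+\lambda_i\,T_{i+1,j,k}T_{i-1,j,k}$. The value $T_{0,0,n}$ is determined by the data with $|i|+|j|\le n-1$ and only involves $\lambda_a,\mu_a$ with $|a|\le n-2$; it is denoted $|A|_{\lambda,\mu}$. An alternating sign matrix (ASM) is a square matrix with entries in $\{0,1,-1\}$ such that in every row and every column the nonzero entries alternate in sign, starting and ending with $1$ (so every row and column sums to $1$). For an ASM $B$ and a position $(i,j)$, the six-vertex type $\mathcal C(B)_{i,j}\in\{a_1,a_2,b_1,b_2,c_1,c_2\}$ (from the standard bijection between ASMs and six-vertex configurations with domain wall boundary conditions) is: $c_1$ if $b_{i,j}=1$; $c_2$ if $b_{i,j}=-1$; and if $b_{i,j}=0$, with $r=\sum_{k\le j}b_{i,k}\in\{0,1\}$ and $s=\sum_{k\le i}b_{k,j}\in\{0,1\}$: $a_1$ if $(r,s)=(0,0)$, $b_1$ if $(r,s)=(0,1)$, $b_2$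 if $(r,s)=(1,0)$, $a_2$ if $(r,s)=(1,1)$. Here $x^0=1$. *)

(* Defs.v *)
From mathcomp Require Import all_boot all_order all_algebra.

Set Implicit Arguments.
Unset Strict Implicit.
Unset Printing Implicit Defensive.

Import Order.TTheory GRing.Theory Num.Theory.
Local Open Scope ring_scope.

Section LambdaDeterminant.

Variables (F : fieldType) (n : nat).
Implicit Types (A : 'M[F]_n) (lam mu : int -> F).

(* 1-based access [a_{r,c}]; the value 0 outside 1..n is never used by the
   determinant. *)
Definition entry A (r c : int) : F :=
  match r, c with
  | Posz r'.+1, Posz c'.+1 =>
      match insub r', insub c' with
      | Some r0, Some c0 => A r0 c0
      | _, _ => 0
      end
  | _, _ => 0
  end.

(* The recursion T_{k+1} T_{k-1} = ... is solved for T_{k+1}. Only the values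
   with i + j + k = n mod 2 and |i| + |j| + k <= n are meaningful (for k = 0,
   |i| + |j| + 2 <= n); the values elsewhere do not enter [lambda_det]. *)
Fixpoint lambdaT A lam mu (i j : int) (k : nat) {struct k} : F :=
  match k with
  | 0 => 1
  | 1 => entry A ((j - i + n%:Z + 1) %/ 2)%Z ((i + j + n%:Z + 1) %/ 2)%Z
  | (k0.+1 as k1).+1 =>
      (mu j * lambdaT A lam mu i (j + 1) k1 * lambdaT A lam mu i (j - 1) k1
       + lam i * lambdaT A lam mu (i + 1) j k1 * lambdaT A lam mu (i - 1) j k1)
      / lambdaT A lam mu i j k0
  end.

Definition lambda_det A lam mu : F := lambdaT A lam mu 0 0 n.

(* The T_{i,j,k} listed here are exactly the divisors met when computing
   T_{0,0,n}: T_{i,j,k+2} with |i| + |j| <= n - (k + 2) is divided by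
   T_{i,j,k}. For k = 1 these are the entries a_{r,c} with 1 < r, c < n. *)
Definition lambda_det_defined A lam mu : Prop :=
  forall (i j : int) (k : nat),
    (i + j + k%:Z = n%:Z %[mod 2])%Z ->
    `|i| + `|j| + k%:Z + 2 <= n%:Z ->
    lambdaT A lam mu i j k != 0.

Lemma lambdaT_rec A lam mu (i j : int) (k : nat) :
  lambda_det_defined A lam mu ->
  (i + j + k%:Z = n%:Z %[mod 2])%Z -> `|i| + `|j| + k%:Z + 2 <= n%:Z ->
  lambdaT A lam mu i j k.+2 * lambdaT A lam mu i j k =
    mu j * lambdaT A lam mu i (j + 1) k.+1 * lambdaT A lam mu i (j - 1) k.+1
    + lam i * lambdaT A lam mu (i + 1) j k.+1 * lambdaT A lam mu (i - 1) j k.+1.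
Proof. by move=> dA par cone; rewrite /= divfK //; apply: dA. Qed.

End LambdaDeterminant.

Definition sign_values : seq int := [:: 0; 1; -1].

Definition sign_entry := seq_sub sign_values.

Definition sign_int (b : sign_entry) : int := val b.

Definition alternating (s : seq int) : bool :=
  let t := [seq x <- s | x != 0] in
  [&& head 0 t == 1, last 0 t == 1 & sorted (fun x y => y == - x) t].

Section AlternatingSignMatrices.

Variable n : nat.

Definition is_asm (B : 'M[sign_entry]_n) : bool :=
  [forall i, alternating [seq sign_int (B i j) | j <- enum 'I_n]] &&
  [forall j, alternating [seq sign_int (B i j) | i <- enum 'I_n]].

Variant vertex_type := Va1 | Va2 | Vb1 | Vb2 | Vc1 | Vc2.

(* For an alternating sign matrix the partial sums r and s lie in {0, 1}. *)
Definition vertex (B : 'M[sign_entry]_n) (i j : 'I_n) : vertex_type :=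
  if sign_int (B i j) == 1 then Vc1
  else if sign_int (B i j) == -1 then Vc2
  else
    let r := \sum_(k < n | (k <= j)%N) sign_int (B i k) in
    let s := \sum_(k < n | (k <= i)%N) sign_int (B k j) in
    match r == 0, s == 0 with
    | true, true => Va1
    | true, false => Vb1
    | false, true => Vb2
    | false, false => Va2
    end.

(* The ordinals i and j are 0-based, hence the successors in the index of mu;
   the shift cancels in the index of lam. *)
Definition weight (F : fieldType) (A : 'M[F]_n) (lam mu : int -> F)
    (B : 'M[sign_entry]_n) (i j : 'I_n) : F :=
  let l := lam (j%:Z - i%:Z) in
  let m := mu (i.+1%:Z + j.+1%:Z - n%:Z - 1) in
  A i j ^ sign_int (B i j) *
  match vertex B i j with
  | Va1 => l
  | Vb1 => m
  | Vc2 => l + m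
  | _ => 1
  end.

End AlternatingSignMatrices.

(* Main.v *)
Require Import Defs.
From mathcomp Require Import all_boot all_order all_algebra.
From mathcomp Require Import zify ring.

(** An alternating sign matrix is encoded by its height function, the matrix of
    its corner sums: heights of size [N] live on the grid [0..N]^2, have fixed
    border values and steps in {0, 1}. Heights [h] of size [N] and [g] of size
    [N.+1] interlace when [h p q] lies between [g p q], [g p.+1 q.+1 - 1] and
    [g p q.+1], [g p.+1 q]; given one of them, the values of the other are
    chosen independently of each other, among two values at the entries -1 of
    [g] (resp. the entries 1 of [h]) and one value elsewhere.

    As in the work of Robbins and Rumsey, T_{0,0,n} is, for every level k, the
    sum over interlacing pairs (h, g) of sizes n - k - 1 and n - k of the
    monomial T_k^(-h) T_{k+1}^g times
      lambda^(1 + h p q - g p.+1 q.+1) mu^(g p q.+1 - h p q),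
    where the exponents of T are the matrices with heights h and g. To pass from
    level k + 1 to level k, fix the height h common to both pairs: the sums over
    the heights below h and above h both factor over the entries of h, and the
    recursion for T_{k+2} identifies the two products. At level 0, where
    T_0 = 1, the sum over the heights below g produces the six-vertex weights. *)

Set Implicit Arguments.
Unset Strict Implicit.
Unset Printing Implicit Defensive.

Import Order.TTheory GRing.Theory Num.Theory.
Local Open Scope ring_scope.

(** * Products over a square *)

Section SquareProducts.

Variable R : comNzRingType.
Implicit Types (N : nat) (G : nat -> nat -> R).

Definition sqprod N G : R := \prod_(p < N) \prod_(q < N) G p q.

Lemma eq_sqprod N G G' :
    (forall p q, (p < N)%N -> (q < N)%N -> G p q = G' p q) ->
  sqprod N G = sqprod N G'.
Proof. by move=> eqG; do 2!apply: eq_bigr => ? _; apply: eqG. Qed.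

Lemma sqprodM N G G' :
  sqprod N (fun p q => G p q * G' p q) = sqprod N G * sqprod N G'.
Proof.
by rewrite /sqprod -big_split; apply: eq_bigr => p _; rewrite big_split.
Qed.

Lemma sqprod1 N G :
  (forall p q, (p < N)%N -> (q < N)%N -> G p q = 1) -> sqprod N G = 1.
Proof. by move=> G1; do 2!apply: big1 => ? _; apply: G1. Qed.

(** The boolean tells which end is dropped: index 0, with a shift of the others, if [a] is true, and
    the last index otherwise. *)
Lemma prod_peel N (a : bool) (g : nat -> R) :
  g (if a then 0 else N)%N = 1 -> \prod_(p < N.+1) g p = \prod_(p < N) g (a + p)%N.
Proof.
by case: a => g1; [rewrite big_ord_recl | rewrite big_ord_recr] => /=;
  rewrite g1 ?mul1r ?mulr1; apply: eq_bigr.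
Qed.

Lemma sqprod_peel N (a b : bool) G :
    (forall i, (i <= N)%N -> G (if a then 0 else N)%N i = 1) ->
    (forall i, (i <= N)%N -> G i (if b then 0 else N)%N = 1) ->
  sqprod N.+1 G = sqprod N (fun p q => G (a + p)%N (b + q)%N).
Proof.
move=> Ga Gb; rewrite /sqprod (@prod_peel N a (fun p => \prod_(q < N.+1) G p q)).
  apply: eq_bigr => p _; apply: (@prod_peel N b (G (a + p)%N)).
  by apply: Gb; case: a {Ga} => /=; have := ltn_ord p; lia.
by apply: big1 => q _; apply: Ga; rewrite -ltnS.
Qed.

Lemma sqprod_inner N G :
    (forall i, (i < N.+2)%N ->
      [/\ G 0%N i = 1, G i 0%N = 1, G N.+1 i = 1 & G i N.+1 = 1]) ->
  sqprod N.+2 G = sqprod N (fun p q => G p.+1 q.+1).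
Proof.
move=> G1; rewrite (@sqprod_peel _ false false) => [|i /G1[]|i /G1[]] //.
by rewrite (@sqprod_peel _ true true) // => i iN; case: (G1 i) => //; lia.
Qed.

Definition padded N (c : nat -> nat -> nat) p q :=
  if (p < N)%N && (q < N)%N then c p q else 0%N.

Definition row_shift (c : nat -> nat -> nat) p q :=
  if p is p'.+1 then c p' q else 0%N.

Definition col_shift (c : nat -> nat -> nat) p q :=
  if q is q'.+1 then c p q' else 0%N.

(* The exponent of [y i j] when every cell (p, q) contributes its diagonal
   corners [s p q] times and its antidiagonal corners [t p q] times. *)
Definition corner_count N (s t : nat -> nat -> nat) i j : nat :=
  (padded N s i j + row_shift (col_shift (padded N s)) i j
   + (col_shift (padded N t) i j + row_shift (padded N t) i j))%N.

(** Each of the four corners of the cells ranges over a square of size [N] in the grid of size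
    [N.+1]; padding with exponent 0 extends its product to the whole grid. *)
Lemma sqprod_corners N (y : nat -> nat -> R) (s t : nat -> nat -> nat) :
  sqprod N (fun p q => (y p q * y p.+1 q.+1) ^+ s p q
                       * (y p q.+1 * y p.+1 q) ^+ t p q)
  = sqprod N.+1 (fun i j => y i j ^+ corner_count N s t i j).
Proof.
have E (a b : bool) c d :
    (forall i, (i <= N)%N -> d (if a then 0 else N)%N i = 0%N) ->
    (forall i, (i <= N)%N -> d i (if b then 0 else N)%N = 0%N) ->
    (forall p q, (p < N)%N -> (q < N)%N -> d (a + p)%N (b + q)%N = c p q) ->
  sqprod N.+1 (fun i j => y i j ^+ d i j)
  = sqprod N (fun p q => y (a + p)%N (b + q)%N ^+ c p q).
  move=> da db dc; rewrite (@sqprod_peel _ a b) => [|i iN|i iN].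
  - by apply: eq_sqprod => p q pN qN; rewrite dc.
  - by rewrite da.
  - by rewrite db.
under [RHS]eq_sqprod do rewrite /corner_count !exprD.
rewrite !sqprodM.
have in_padded c p q : (p < N)%N -> (q < N)%N -> padded N c p q = c p q.
  by move=> pN qN; rewrite /padded pN qN.
have padded_r c i : padded N c i N = 0%N by rewrite /padded ltnn andbF.
have padded_l c i : padded N c N i = 0%N by rewrite /padded ltnn.
rewrite (E false false s) //.
rewrite (E true true s) //.
rewrite (E false true t) //.
rewrite (E true false t) //.
rewrite -!sqprodM; apply: eq_sqprod => p q _ _.
by rewrite !add0n !add1n !exprMn mulrA.
all: by [exact: in_padded | case | case=> [|i] _ /=].
Qed.

End SquareProducts.

(** * Height functions *)

Section Heights.

Implicit Types (N p q : nat) (h g : nat -> nat -> nat).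

(** The entry (p, q) of the matrix whose corner sums are [h]. *)
Definition mixed_diff h p q : int :=
  (h p.+1 q.+1)%:Z + (h p q)%:Z - (h p q.+1)%:Z - (h p.+1 q)%:Z.

Definition asm_border N h : bool :=
  [forall i : 'I_N.+1,
    [&& h 0 i == 0, h i 0 == 0, h N i == i & h i N == i]%N].

Definition unit_steps N h : bool :=
  [forall p : 'I_N.+1, forall q : 'I_N,
    (h p q <= h p q.+1 <= (h p q).+1)%N && (h q p <= h q.+1 p <= (h q p).+1)%N].

Definition asm_height N h : bool := asm_border N h && unit_steps N h.

(* [cell_lo] and [cell_hi] bound the value, inside the cell (p, q) of [h], of an
   interlacing height of smaller size; [vertex_lo] and [vertex_hi] bound the
   value at the grid point (p.+1, q.+1) of one of larger size. *)
Definition cell_lo h p q := maxn (h p q) (h p.+1 q.+1).-1.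
Definition cell_hi h p q := minn (h p q.+1) (h p.+1 q).
Definition vertex_lo h p q := maxn (h p q.+1) (h p.+1 q).
Definition vertex_hi h p q := minn (h p q).+1 (h p.+1 q.+1).

(** The first height is the smaller one: [g] has size [N] and [h] size [N.+1]. *)
Definition interlace N g h : bool :=
  [forall p : 'I_N.+1, forall q : 'I_N.+1,
    (cell_lo h p q <= g p q <= cell_hi h p q)%N].

Lemma asm_borderP N h :
  reflect (forall i, (i <= N)%N ->
             [/\ h 0 i = 0, h i 0 = 0, h N i = i & h i N = i]%N)
          (asm_border N h).
Proof.
apply: (iffP forallP) => [bh i iN | bh i].
  by have /and4P[/eqP-> /eqP-> /eqP-> /eqP->] := bh (Ordinal (iN : (i < N.+1)%N)).
by have [] := bh i; [rewrite -ltnS | do 4!move->; rewrite !eqxx].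
Qed.

Lemma unit_stepsP N h :
  reflect (forall p q, (p <= N)%N -> (q < N)%N ->
             [/\ h p q <= h p q.+1, h p q.+1 <= (h p q).+1,
                 h q p <= h q.+1 p & h q.+1 p <= (h q p).+1]%N)
          (unit_steps N h).
Proof.
apply: (iffP forallP) => [sh p q pN qN | sh p].
  have /forallP/(_ (Ordinal qN)) := sh (Ordinal (pN : (p < N.+1)%N)).
  by case/andP => /andP[? ?] /andP[? ?].
apply/forallP => q; have [] := sh p q _ (ltn_ord q); first by rewrite -ltnS.
by move=> -> -> -> ->.
Qed.

Lemma interlaceP N g h :
  reflect (forall p q, (p <= N)%N -> (q <= N)%N ->
             (cell_lo h p q <= g p q <= cell_hi h p q)%N)
          (interlace N g h).
Proof.
apply: (iffP forallP) => [gh p q pN qN | gh p].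
  by have /forallP/(_ (Ordinal (qN : (q < N.+1)%N))) :=
    gh (Ordinal (pN : (p < N.+1)%N)).
by apply/forallP => q; apply: gh; rewrite -ltnS.
Qed.

Lemma asm_height_le N h p q :
  asm_height N h -> (p <= N)%N -> (q <= N)%N -> (h p q <= p)%N && (h p q <= q)%N.
Proof.
case/andP=> /asm_borderP bh /unit_stepsP sh pN qN; apply/andP; split.
  elim: p pN => [|p IHp] pN; first by have [] := bh _ qN; lia.
  by have [] := sh q p; try lia.
elim: q qN => [|q IHq] qN; first by have [] := bh _ pN; lia.
by have [] := sh p q; try lia.
Qed.

Lemma interlace_cell N g h p q :
    interlace N g h -> (p <= N)%N -> (q <= N)%N ->
  [/\ h p q <= g p q, h p.+1 q.+1 <= (g p q).+1,
      g p q <= h p q.+1 & g p q <= h p.+1 q]%N.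
Proof.
move/interlaceP=> gh pN qN; have := gh p q pN qN.
rewrite /cell_lo /cell_hi geq_max leq_min -!andbA -ltnS => /and4P[? ? ? ?].
by split=> //; lia.
Qed.

(** Border cells of [h] leave a single value, and the steps of [g] are bounded through [g p q <= h p
    q.+1 <= g p q.+1 <= h p.+1 q.+1 <= (g p q).+1]. *)
Lemma interlace_below N g h :
  asm_height N.+1 h -> interlace N g h -> asm_height N g.
Proof.
case/andP=> /asm_borderP bh _ gh; apply/andP; split.
  apply/asm_borderP => i iN.
  have [h1 h2 h3 h4] := bh i (leqW iN).
  have [h5 h6 h7 h8] := bh i.+1 iN.
  by have [] := (interlace_cell gh (leq0n N) iN);
     have [] := (interlace_cell gh iN (leq0n N));
     have [] := (interlace_cell gh (leqnn N) iN);
     have [] := (interlace_cell gh iN (leqnn N));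
     rewrite h1 h2 h3 h4 h7 h8; split; lia.
apply/unit_stepsP => p q pN qN.
by have [] := interlace_cell gh pN (ltnW qN); have [] := interlace_cell gh pN qN;
   have [] := interlace_cell gh (ltnW qN) pN; have [] := interlace_cell gh qN pN;
   split; lia.
Qed.

(** A step of [h] along a row is compared with one value of [g]: its lower bound comes from the cell
    below it, its upper bound from the cell above. Where that cell is missing, the border values
    apply. Columns are symmetric. *)
Lemma interlace_above N g h :
    asm_border N.+1 h -> interlace N g h -> asm_height N.+1 h.
Proof.
move=> bh gh; apply/andP; split=> //; move/asm_borderP: bh => bh.
apply/unit_stepsP => p q pN qN.
have [h1 h2 h3 h4] := bh q (ltnW qN).
have [h5 h6 h7 h8] := bh q.+1 qN.
have lo : (0 < p)%N -> [/\ h p q.+1 <= (h p q).+1 & h q.+1 p <= (h q p).+1]%N.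
  case: p pN => // p pN _.
  by have [] := interlace_cell gh pN qN; have [] := interlace_cell gh qN pN; split; lia.
have hi : (p <= N)%N -> [/\ h p q <= h p q.+1 & h q p <= h q.+1 p]%N.
  move=> pN'.
  by have [] := interlace_cell gh pN' qN; have [] := interlace_cell gh qN pN'; split; lia.
case: p pN lo hi => [|p] pN lo hi.
  by case: (hi _) => //; split; lia.
case: (lo _) => // lo1 lo2.
have [pN' | pN'] := ltnP p N; first by case: hi => // ? ?; split.
have {pN'}-> : p = N by lia.
by split; lia.
Qed.

Lemma vertex_interlace L g h p q :
    interlace L.+1 g h -> (p <= L)%N -> (q <= L)%N ->
  (vertex_lo g p q <= h p.+1 q.+1 <= vertex_hi g p q)%N.
Proof.
move=> gh pL qL; rewrite /vertex_lo /vertex_hi geq_max leq_min.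
have [-> _ _ _] := @interlace_cell L.+1 g h p.+1 q.+1 gh pL qL.
have [_ -> _ _] := interlace_cell gh (leqW pL) (leqW qL).
have [_ _ -> _] := @interlace_cell L.+1 g h p.+1 q gh pL (leqW qL).
by have [_ _ _ ->] := @interlace_cell L.+1 g h p q.+1 gh (leqW pL) qL.
Qed.

(* The heights of size [L.+2] above a given [g] of size [L.+1] are obtained by
   independent choices, one per grid point. *)
Definition above_choices L g P Q (v : nat) : bool :=
  if (P == 0)%N || (Q == 0)%N then v == 0%N
  else if P == L.+2 then v == Q
  else if Q == L.+2 then v == P
  else (vertex_lo g P.-1 Q.-1 <= v <= vertex_hi g P.-1 Q.-1)%N.

Lemma above_choicesP L g h :
    asm_border L.+1 g ->
  reflect (forall P Q, (P <= L.+2)%N -> (Q <= L.+2)%N ->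
             above_choices L g P Q (h P Q))
          (asm_border L.+2 h && interlace L.+1 g h).
Proof.
move=> /asm_borderP bg; apply: (iffP andP) => [[/asm_borderP bh gh] P Q PL QL | ok].
  rewrite /above_choices; case: ifPn => [/orP[]/eqP-> | /norP[P0 Q0]].
  - by have [-> _ _ _] := bh _ QL.
  - by have [_ -> _ _] := bh _ PL.
  case: eqP => [->|PL2]; first by have [_ _ -> _] := bh _ QL.
  case: eqP => [->|QL2]; first by have [_ _ _ ->] := bh _ PL.
  case: P P0 PL PL2 => // p _ pL PL2; case: Q Q0 QL QL2 => // q _ qL QL2 /=.
  have {PL2} pL' : (p.+1 <= L.+1)%N by lia.
  have {QL2} qL' : (q.+1 <= L.+1)%N by lia.
  exact: vertex_interlace gh pL' qL'.
have inner p q : (p <= L)%N -> (q <= L)%N ->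
    (vertex_lo g p q <= h p.+1 q.+1 <= vertex_hi g p q)%N.
  move=> pL qL; have := ok p.+1 q.+1; rewrite /above_choices /= !eqSS.
  by rewrite !ifN; [apply; lia | lia | lia].
have h0l i : (i <= L.+2)%N -> h 0%N i = 0%N by move=> /(ok 0%N _ isT)/eqP.
have h0r i : (i <= L.+2)%N -> h i 0%N = 0%N.
  by move=> iL; have := ok i 0%N iL isT; rewrite /above_choices eqxx orbT => /eqP.
have hNl i : (i <= L.+2)%N -> h L.+2 i = i.
  case: i => [|i] iL; first exact: h0r.
  by have := ok _ _ (leqnn _) iL; rewrite /above_choices /= eqxx => /eqP.
have hNr i : (i <= L.+2)%N -> h i L.+2 = i.
  case: i => [|i] iL; first exact: h0l.
  have := ok _ _ iL (leqnn _); rewrite /above_choices /= eqxx.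
  by case: eqP => [-> | _] /eqP.
split; first by apply/asm_borderP => i iL; split; auto.
apply/interlaceP => p q pL qL; rewrite /cell_lo /cell_hi geq_max leq_min.
have [gp1 gp2 gp3 gp4] := bg _ pL; have [gq1 gq2 gq3 gq4] := bg _ qL.
(* Each of the four inequalities involves one corner of the cell; an inner corner is governed by
   [inner], a border corner by the border values. *)
apply/andP; split; apply/andP; split.
- case: p pL {gp1 gp2 gp3 gp4} => [|p] pL; first by rewrite h0l //; lia.
  case: q qL {gq1 gq2 gq3 gq4} => [|q] qL; first by rewrite h0r //; lia.
  by have /andP[_] := inner p q pL qL; rewrite leq_min => /andP[].
- rewrite -subn1 leq_subLR add1n.
  have [pL' | pL'] := ltnP p L.+1; last first.
    have -> : p = L.+1 by lia.
    by rewrite hNl ?gq3 //; lia.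
  have [qL' | qL'] := ltnP q L.+1; last first.
    have -> : q = L.+1 by lia.
    by rewrite hNr ?gp4 //; lia.
  by have /andP[_] := inner p q pL' qL'; rewrite leq_min => /andP[].
- have [qL' | qL'] := ltnP q L.+1; last first.
    have -> : q = L.+1 by lia.
    by rewrite hNr ?gp4 //; lia.
  case: p pL {gp1 gp2 gp3 gp4} => [|p] pL; first by rewrite gq1; lia.
  by have /andP[] := inner p q pL qL'; rewrite geq_max => /andP[].
have [pL' | pL'] := ltnP p L.+1; last first.
  have -> : p = L.+1 by lia.
  by rewrite hNl ?gq3 //; lia.
case: q qL {gq1 gq2 gq3 gq4} => [|q] qL; first by rewrite gp2; lia.
by have /andP[] := inner p q pL' qL; rewrite geq_max => /andP[].
Qed.

End Heights.

(** * Exponents at the grid points of a square of cells *)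

Lemma eq_corner_count N (s s' t t' : nat -> nat -> nat) :
  s =2 s' -> t =2 t' -> corner_count N s t =2 corner_count N s' t'.
Proof.
move=> ss tt i j; rewrite /corner_count.
by case: i j => [|i] [|j]; rewrite /= /padded ?ss ?tt.
Qed.

Lemma corner_countC N (s t : nat -> nat -> nat) i j :
  corner_count N (fun p q => s q p) (fun p q => t q p) j i = corner_count N s t i j.
Proof.
have padC c p q : padded N (fun p q => c q p) q p = padded N c p q.
  by rewrite /padded andbC.
by rewrite /corner_count; case: i j => [|i] [|j] /=; rewrite ?(padC s) ?(padC t); lia.
Qed.

(** A border point is a corner of border cells only, and these have exponent 0. The columns follow
    from the rows by transposition. *)
Lemma corner_count_border L (s t : nat -> nat -> nat) i :
    (forall j, (j <= L)%N -> [/\ s 0 j = 0, s j 0 = 0, s L j = 0 & s j L = 0]%N) ->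
    (forall j, (j <= L)%N -> [/\ t 0 j = 0, t j 0 = 0, t L j = 0 & t j L = 0]%N) ->
    (i < L.+2)%N ->
  [/\ corner_count L.+1 s t 0 i = 0, corner_count L.+1 s t i 0 = 0,
      corner_count L.+1 s t L.+1 i = 0 & corner_count L.+1 s t i L.+1 = 0]%N.
Proof.
have row (u v : nat -> nat -> nat) :
    (forall j, (j <= L)%N -> [/\ u 0 j = 0, u j 0 = 0, u L j = 0 & u j L = 0]%N) ->
    (forall j, (j <= L)%N -> [/\ v 0 j = 0, v j 0 = 0, v L j = 0 & v j L = 0]%N) ->
    (i < L.+2)%N ->
    corner_count L.+1 u v 0 i = 0%N /\ corner_count L.+1 u v L.+1 i = 0%N.
  move=> u0 v0 iL; rewrite /corner_count /padded /= ltnn ltnSn /=.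
  case: i iL => [|i] iL /=.
    by have [-> _ _ _] := u0 0%N isT; have [_ -> _ _] := v0 L (leqnn L).
  have [_ _ -> _] := u0 i iL; have [-> _ _ _] := v0 i iL.
  rewrite ltnn /= !if_same; case: (ltnP i.+1 L.+1) => [iL' | _] //.
  by have [-> _ _ _] := u0 i.+1 iL'; have [_ _ -> _] := v0 i.+1 iL'.
move=> s0 t0 iL; have [-> ->] := row s t s0 t0 iL.
rewrite -!(corner_countC _ s t).
have [||-> ->] // := row (fun p q => s q p) (fun p q => t q p) _ _ iL.
  by move=> j /s0[].
by move=> j /t0[].
Qed.

(** * Sums over heights as products of local sums *)

Section HeightSums.

Variables (F : fieldType) (K : nat).
Implicit Types (N L p q : nat) (y l m : nat -> nat -> F).

(** A finite type, so that heights can be summed over; one bound [K] on the values serves all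
    sizes. *)
Definition height N := {ffun 'I_N.+1 * 'I_N.+1 -> 'I_K.+1}.

Definition hval N (f : height N) p q : nat := f (inord p, inord q).

(** Distributivity: independent choices at the grid points turn a sum of products into a product of
    sums. *)
Lemma sum_choices N (ok : nat -> nat -> pred nat) (G : nat -> nat -> nat -> F) :
  \sum_(f : height N | [forall p : 'I_N.+1, forall q : 'I_N.+1,
                          ok p q (hval f p q)])
    sqprod N.+1 (fun p q => G p q (hval f p q))
  = sqprod N.+1 (fun p q => \sum_(v < K.+1 | ok p q v) G p q v).
Proof.
rewrite /sqprod [RHS]pair_big /=.
rewrite (bigA_distr_big_dep
  (fun (ij : 'I_N.+1 * 'I_N.+1) (v : 'I_K.+1) => ok ij.1 ij.2 v)
  (fun ij v => G ij.1 ij.2 v)) /=.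
apply: eq_big => [f | f _].
  apply/forallP/familyP => [okf [p q] | okf p].
    by have /forallP/(_ q) := okf p; rewrite /hval !inord_val.
  by apply/forallP => q; have := okf (p, q); rewrite /hval !inord_val.
by rewrite pair_big; apply: eq_bigr => -[p q] _; rewrite /hval !inord_val.
Qed.

(** Here [g] is the smaller height. The truncated subtractions are exact when [g] and [h]
    interlace. *)
Definition pair_weight N l m (g h : nat -> nat -> nat) : F :=
  sqprod N.+1 (fun p q => l p q ^+ ((g p q).+1 - h p.+1 q.+1)
                          * m p q ^+ (h p q.+1 - g p q)).

(** The value [v] in a cell lowers the exponents at its diagonal corners, with product [a], and
    raises those at its antidiagonal corners, with product [b]. The bounds of the cell make both
    exponents nonnegative; [residual] corrects for this. *)
Definition below_term (l m a b : F) (h : nat -> nat -> nat) p q v : F :=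
  l ^+ (v.+1 - h p.+1 q.+1) * m ^+ (h p q.+1 - v)
  * (a ^+ (cell_hi h p q - v) * b ^+ (v - cell_lo h p q)).

(** Dual to [below_term]: now [v] sits at the point (p.+1, q.+1) and the signs are reversed. The
    exponent of [m] is that of the cell (p.+1, q), of which this point is an upper corner. *)
Definition above_term (l m a b : F) (g : nat -> nat -> nat) p q v : F :=
  l ^+ ((g p q).+1 - v) * m ^+ (v - g p.+1 q)
  * (a ^+ (v - vertex_lo g p q) * b ^+ (vertex_hi g p q - v)).

Definition below_sum l m y (h : nat -> nat -> nat) p q : F :=
  \sum_(v < K.+1 | (cell_lo h p q <= v <= cell_hi h p q)%N)
    below_term (l p q) (m p q) (y p q * y p.+1 q.+1) (y p q.+1 * y p.+1 q) h p q v.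

Definition above_sum l m y (g : nat -> nat -> nat) p q : F :=
  \sum_(v < K.+1 | (vertex_lo g p q <= v <= vertex_hi g p q)%N)
    above_term (l p q) (m p q) (y p q * y p.+1 q.+1) (y p q.+1 * y p.+1 q) g p q v.

(* The exponent of [y p.+1 q.+1] that does not depend on the choices. Since
   [vertex_lo + cell_hi] and [vertex_hi + cell_lo] are sums of values of [h], it
   is the same for the heights below [h] and for those above. *)
Definition residual (h : nat -> nat -> nat) p q : int :=
  (cell_lo h p.+1 q + cell_lo h p q.+1)%N%:Z
  - (cell_hi h p q + cell_hi h p.+1 q.+1)%N%:Z.

(** A border cell leaves at most one value, so the exponents of [a] and [b] in [below_term] vanish
    there. *)
Lemma border_cell L h i :
    asm_height L.+1 h -> (i <= L)%N ->
  [/\ cell_hi h 0 i <= cell_lo h 0 i, cell_hi h i 0 <= cell_lo h i 0,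
      cell_hi h L i <= cell_lo h L i & cell_hi h i L <= cell_lo h i L]%N.
Proof.
case/andP=> /asm_borderP bh _ iL.
have [h1 h2 h3 h4] := bh i (leqW iL); have [h5 h6 h7 h8] := bh i.+1 iL.
rewrite /cell_hi /cell_lo h3 h4 h5 h6 h7 h8.
by split; rewrite ?min0n ?minn0 ?leq_max //= ?geq_minr ?geq_minl ?orbT.
Qed.

(** The heights below [h] are independent choices in its cells. Regrouping the factors by grid
    points leaves nothing on the border, and at inner points the bounds cancel against
    [residual]. *)
Lemma sum_below L l m y (h : nat -> nat -> nat) :
    asm_height L.+1 h ->
    (forall p q, (p < L)%N -> (q < L)%N -> y p.+1 q.+1 != 0) ->
  \sum_(g : height L | interlace L (hval g) h)
    pair_weight L l m (hval g) h
    * sqprod L (fun p q => y p.+1 q.+1 ^ (- mixed_diff (hval g) p q))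
  = sqprod L.+1 (below_sum l m y h)
    * sqprod L (fun p q => y p.+1 q.+1 ^ residual h p q).
Proof.
move=> hh y0.
rewrite /below_sum -(@sum_choices L
  (fun p q v => cell_lo h p q <= v <= cell_hi h p q)%N
  (fun p q => below_term (l p q) (m p q) (y p q * y p.+1 q.+1)
                         (y p q.+1 * y p.+1 q) h p q)).
rewrite mulr_suml; apply: eq_bigr => g /interlaceP gh.
rewrite /below_term sqprodM -mulrA; congr (_ * _).
rewrite (sqprod_corners _ y (fun p q => cell_hi h p q - hval g p q)%N
                            (fun p q => hval g p q - cell_lo h p q)%N).
rewrite sqprod_inner => [|i iL]; last first.
  have [||->->->->] := @corner_count_border L
    (fun p q => cell_hi h p q - hval g p q)%N
    (fun p q => hval g p q - cell_lo h p q)%N i _ _ iL; last by rewrite !expr0.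
    move=> j jL; have [? ? ? ?] := border_cell hh jL.
    have := gh _ _ (leq0n L) jL; have := gh _ _ jL (leq0n L).
    by have := gh _ _ (leqnn L) jL; have := gh _ _ jL (leqnn L); split; lia.
  move=> j jL; have [? ? ? ?] := border_cell hh jL.
  have := gh _ _ (leq0n L) jL; have := gh _ _ jL (leq0n L).
  by have := gh _ _ (leqnn L) jL; have := gh _ _ jL (leqnn L); split; lia.
rewrite -sqprodM; apply: eq_sqprod => p q pL qL.
rewrite exprnP -expfzDr ?y0 //; congr (_ ^ _).
rewrite /corner_count /padded /= !ltnS pL qL !(ltnW pL) !(ltnW qL) /=.
rewrite /residual /mixed_diff.
have := gh _ _ pL qL; have := gh _ _ (ltnW pL) qL.
have := gh _ _ pL (ltnW qL); have := gh _ _ (ltnW pL) (ltnW qL).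
lia.
Qed.

(** On the border the exponents are natural numbers, without [residual], so [y] may vanish there. *)
Lemma mixed_diff_border_rows L (g h : nat -> nat -> nat) j :
    (forall q, (q <= L.+1)%N -> [/\ g 0 q = 0, g q 0 = 0, g L.+1 q = q & g q L.+1 = q]%N) ->
    (forall q, (q <= L.+2)%N -> [/\ h 0 q = 0, h q 0 = 0, h L.+2 q = q & h q L.+2 = q]%N) ->
    (forall p q, (p < L.+1)%N -> (q <= L.+1)%N -> (g p q <= g p.+1 q <= (g p q).+1)%N) ->
    (forall p q, (p <= L)%N -> (q <= L)%N ->
       (vertex_lo g p q <= h p.+1 q.+1 <= vertex_hi g p q)%N) ->
    (j < L.+2)%N ->
  let cnt := corner_count L.+1 (fun p q => h p.+1 q.+1 - vertex_lo g p q)%N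
                               (fun p q => vertex_hi g p q - h p.+1 q.+1)%N in
  mixed_diff h 0 j = cnt 0%N j /\ mixed_diff h L.+1 j = cnt L.+1 j.
Proof.
move=> bg bh sg gh jL; rewrite /corner_count /padded /mixed_diff /=.
rewrite !ltnn !ltnSn /= !addn0 !add0n.
have [h1 _ h3 _] := bh _ (ltnW jL); have [h5 _ h7 _] := bh _ jL.
have [g1 g2 g3 g4] := bg j jL.
have lo := sg 0%N j isT jL.
have hi := sg L j (ltnSn L) jL.
(* [A] and [B] compare two neighbours in the first inner row of [h] with the same value [g 1 j]; [C]
   and [D] do so in the last inner row with [g L j]. Subtraction eliminates [g]. *)
have A : (h 1%N j.+1
    = g 1%N j + if (j < L.+1)%N then h 1%N j.+1 - vertex_lo g 0 j else 0)%N.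
  case: ltnP => jL'.
    by have := gh 0%N j isT jL'; rewrite /vertex_lo; have [-> _ _ _] := bg _ jL'; lia.
  have -> : j = L.+1 by lia.
  by have [_ _ _ ->] := bh 1%N isT; have [_ _ _ ->] := bg 1%N isT.
have B : (h 1%N j + (if j is q'.+1 then
      if (q' < L.+1)%N then vertex_hi g 0 q' - h 1%N q'.+1 else 0 else 0)
    = g 1%N j)%N.
  case: j jL g1 lo {A hi h1 h3 h5 h7 g2 g3 g4} => [|j] jL g1 lo.
    by have [_ -> _ _] := bh 1%N isT; have [_ -> _ _] := bg 1%N isT.
  have := gh 0%N j isT jL; rewrite (jL : (j < L.+1)%N) /vertex_hi.
  by have [-> _ _ _] := bg _ (leqW jL); lia.
have C : (h L.+1 j = g L j + if j is q'.+1 then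
      if (q' < L.+1)%N then h L.+1 q'.+1 - vertex_lo g L q' else 0 else 0)%N.
  case: j jL g3 hi {A B lo h1 h3 h5 h7 g1 g2 g4} => [|j] jL g3 hi.
    have [_ -> _ _] := bh L.+1 (leqW (leqnn _)).
    by have [_ -> _ _] := bg L (leqW (leqnn _)).
  have := gh L j (leqnn _) jL; rewrite (jL : (j < L.+1)%N) /vertex_lo.
  by have [_ _ -> _] := bg _ (leqW jL); lia.
have D : (h L.+1 j.+1
    + (if (j < L.+1)%N then vertex_hi g L j - h L.+1 j.+1 else 0)
    = (g L j).+1)%N.
  case: ltnP => jL'.
    by have := gh L j (leqnn _) jL'; rewrite /vertex_hi; have [_ _ -> _] := bg _ jL'; lia.
  have -> : j = L.+1 by lia.
  have [_ _ _ ->] := bh L.+1 (leqW (leqnn _)).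
  by have [_ _ _ ->] := bg L (leqW (leqnn _)); rewrite addn0.
case: j {g1 g2 g3 g4 lo hi} jL h1 h3 h5 h7 A B C D => [|j] jL h1 h3 h5 h7.
  by rewrite /=; split; lia.
by rewrite /= ltnn ltnSn /= => A B C D; split; lia.
Qed.

Lemma mixed_diff_border L (g h : nat -> nat -> nat) i :
    asm_height L.+1 g -> asm_border L.+2 h -> interlace L.+1 g h -> (i < L.+2)%N ->
  let cnt := corner_count L.+1 (fun p q => h p.+1 q.+1 - vertex_lo g p q)%N
                               (fun p q => vertex_hi g p q - h p.+1 q.+1)%N in
  [/\ mixed_diff h 0 i = cnt 0%N i, mixed_diff h i 0 = cnt i 0%N,
      mixed_diff h L.+1 i = cnt L.+1 i & mixed_diff h i L.+1 = cnt i L.+1].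
Proof.
case/andP=> bg /unit_stepsP sg bh gh iL.
have vh := vertex_interlace gh.
move/asm_borderP in bg; move/asm_borderP in bh.
have [|-> ->] := mixed_diff_border_rows bg bh _ vh iL.
  by move=> p q pL qL; have [_ _ -> ->] := sg q p qL pL.
have mdC j k : mixed_diff h j k = mixed_diff (fun p q => h q p) k j.
  by rewrite /mixed_diff; lia.
have vloC p q : vertex_lo g p q = vertex_lo (fun p q => g q p) q p by exact: maxnC.
have [||||c0 cL] := @mixed_diff_border_rows L
  (fun p q => g q p) (fun p q => h q p) i _ _ _ _ iL.
- by move=> q /bg[].
- by move=> q /bh[].
- by move=> p q pL qL; have [-> -> _ _] := sg q p qL pL.
- by move=> p q pL qL; rewrite -vloC; apply: vh.
have vE : corner_count L.+1
     (fun p q => h q.+1 p.+1 - vertex_lo (fun p q => g q p) p q)%N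
     (fun p q => vertex_hi (fun p q => g q p) p q - h q.+1 p.+1)%N =2
   corner_count L.+1 (fun p q => h q.+1 p.+1 - vertex_lo g q p)%N
     (fun p q => vertex_hi g q p - h q.+1 p.+1)%N.
  by apply: eq_corner_count => p q //; rewrite vloC.
have vC := corner_countC L.+1 (fun p q => h p.+1 q.+1 - vertex_lo g p q)%N
  (fun p q => vertex_hi g p q - h p.+1 q.+1)%N.
by split; rewrite // mdC ?c0 ?cL vE vC.
Qed.

End HeightSums.

(** * Sums over the heights above a fixed height *)

Section SumAbove.
Variables (F : fieldType) (K : nat).
Implicit Types (N L p q : nat) (y l m : nat -> nat -> F).

(** The powers of [l] are trivial in the last row and column, those of [m] in the first row and last
    column. Reindexing the latter makes each factor depend on the single value [h p.+1 q.+1]. *)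
Lemma pair_weight_above L l m (g h : nat -> nat -> nat) :
    asm_border L.+1 g -> asm_border L.+2 h ->
  pair_weight L.+1 l m g h
  = sqprod L.+1 (fun p q => l p q ^+ ((g p q).+1 - h p.+1 q.+1)
                            * m p.+1 q ^+ (h p.+1 q.+1 - g p.+1 q)).
Proof.
move=> /asm_borderP bg /asm_borderP bh; rewrite /pair_weight !sqprodM.
rewrite (@sqprod_peel _ _ false false) => [|i iL|i iL]; last 2 first.
- have [_ _ -> _] := bg _ iL; have [_ _ -> _] := bh i.+1 iL.
  by rewrite subnn.
- have [_ _ _ ->] := bg _ iL; have [_ _ _ ->] := bh i.+1 iL.
  by rewrite subnn.
rewrite [X in _ * X](@sqprod_peel _ _ true false) => [|i iL|i iL] //; last 1 first.
- have [_ _ _ ->] := bg _ iL; have [_ _ _ ->] := bh i (leqW iL).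
  by rewrite subnn.
by have [-> _ _ _] := bh i.+1 iL; rewrite sub0n.
Qed.

Lemma sqprod_above L y (g h : nat -> nat -> nat) :
    asm_height L.+1 g -> asm_border L.+2 h -> interlace L.+1 g h ->
    (forall p q, (p < L)%N -> (q < L)%N -> y p.+1 q.+1 != 0) ->
  sqprod L.+2 (fun i j => y i j ^ mixed_diff h i j)
  = sqprod L.+1 (fun p q =>
        (y p q * y p.+1 q.+1) ^+ (h p.+1 q.+1 - vertex_lo g p q)
        * (y p q.+1 * y p.+1 q) ^+ (vertex_hi g p q - h p.+1 q.+1))
    * sqprod L (fun p q => y p.+1 q.+1 ^ residual g p q).
Proof.
move=> ag bh gh y0.
rewrite (sqprod_corners _ y (fun p q => h p.+1 q.+1 - vertex_lo g p q)%N
                            (fun p q => vertex_hi g p q - h p.+1 q.+1)%N).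
set cnt := corner_count _ _ _.
have inner : sqprod L.+2 (fun i j => y i j ^ (mixed_diff h i j - (cnt i j)%:Z))
    = sqprod L (fun p q => y p.+1 q.+1 ^ residual g p q).
  rewrite sqprod_inner => [|i iL]; last first.
    have [-> -> -> ->] := mixed_diff_border ag bh gh iL.
    by rewrite !subrr !expr0z.
  apply: eq_sqprod => p q pL qL; congr (_ ^ _).
  rewrite /cnt /corner_count /padded /= !ltnS pL qL !(ltnW pL) !(ltnW qL) /=.
  have /unit_stepsP sg := proj2 (andP ag).
  have steps i j : (i < L.+1)%N -> (j < L.+1)%N ->
      vertex_lo g i j + cell_hi g i j = g i.+1 j + g i j.+1 /\
      vertex_hi g i j + cell_lo g i j = g i j + g i.+1 j.+1.
    rewrite /vertex_lo /vertex_hi /cell_lo /cell_hi => iL jL.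
    by have [] := sg i j; have [] := sg i.+1 j;
       have [] := sg j i; have [] := sg j.+1 i; lia.
  have vh := vertex_interlace gh.
  rewrite /residual /mixed_diff.
  have := vh _ _ pL qL; have := vh _ _ (ltnW pL) qL.
  have := vh _ _ pL (ltnW qL); have := vh _ _ (ltnW pL) (ltnW qL).
  have := steps p q; have := steps p.+1 q.
  have := steps p q.+1; have := steps p.+1 q.+1.
  lia.
rewrite mulrC -inner -sqprodM; apply: eq_sqprod => i j iL jL.
(* An exponent splits if the base is nonzero, as at inner points, or if nothing remains, as on the
   border. *)
have cast (c : int) (z : F) (k : nat) :
    z != 0 \/ c = k -> z ^ c = z ^ (c - k%:Z) * z ^+ k.
  case=> [z0 | ->]; last by rewrite subrr expr0z mul1r.
  by rewrite exprnP -expfzDr // subrK.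
apply: cast.
have [i1 i2 i3 i4] := mixed_diff_border ag bh gh iL.
have [j1 j2 j3 j4] := mixed_diff_border ag bh gh jL.
case: i iL i1 i2 i3 i4 => [|i] iL i1 i2 i3 i4; first by right; rewrite j1.
case: j jL j1 j2 j3 j4 => [|j] jL j1 j2 j3 j4; first by right; rewrite i2.
have [iL' | iL'] := ltnP i L; last first.
  by right; rewrite (_ : i = L) ?j3 //; lia.
have [jL' | jL'] := ltnP j L; last first.
  by right; rewrite (_ : j = L) ?i4 //; lia.
by left; apply: y0.
Qed.

Lemma sum_above L l m y (g : nat -> nat -> nat) :
    asm_height L.+1 g -> (L.+2 <= K)%N ->
    (forall p q, (p < L)%N -> (q < L)%N -> y p.+1 q.+1 != 0) ->
  \sum_(h : height K L.+2 | asm_height L.+2 (hval h) && interlace L.+1 g (hval h))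
    pair_weight L.+1 l m g (hval h)
    * sqprod L.+2 (fun p q => y p q ^ mixed_diff (hval h) p q)
  = sqprod L.+1 (above_sum K l (fun p q => m p.+1 q) y g)
    * sqprod L (fun p q => y p.+1 q.+1 ^ residual g p q).
Proof.
move=> ag LK y0; have bg := proj1 (andP ag).
(* Border points carry the factor 1, since the value there is forced. *)
pose G (P Q v : nat) : F :=
  if [|| P == 0, Q == 0, P == L.+2 | Q == L.+2]%N then 1 else
  above_term (l P.-1 Q.-1) (m P Q.-1)
    (y P.-1 Q.-1 * y P Q) (y P.-1 Q * y P Q.-1) g P.-1 Q.-1 v.
have Ginner (p q v : nat) : (p < L.+1)%N -> (q < L.+1)%N -> G p.+1 q.+1 v =
    above_term (l p q) (m p.+1 q) (y p q * y p.+1 q.+1) (y p q.+1 * y p.+1 q) g p q v.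
  by move=> pL qL; rewrite /G /= !eqSS !ltn_eqF.
have -> : sqprod L.+1 (above_sum K l (fun p q => m p.+1 q) y g)
    = sqprod L.+3 (fun P Q => \sum_(v < K.+1 | above_choices L g P Q v) G P Q v).
  rewrite sqprod_inner => [|i iL].
    apply: eq_sqprod => p q pL qL; apply: eq_big => [v | v _]; last by rewrite Ginner.
    by rewrite /above_choices /= !eqSS !ltn_eqF.
  have sum1 (P Q c : nat) : (c <= K)%N -> above_choices L g P Q =1 pred1 c ->
      [|| P == 0, Q == 0, P == L.+2 | Q == L.+2]%N ->
      \sum_(v < K.+1 | above_choices L g P Q v) G P Q v = 1.
    move=> cK okc PQ; rewrite (big_pred1 (Ordinal (cK : (c < K.+1)%N))) => [|v].
      by rewrite /G PQ.
    by rewrite okc.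
  have iK : (i <= K)%N by lia.
  split.
  - exact: (sum1 _ _ 0%N).
  - by apply: (sum1 _ _ 0%N) => [//|v|]; rewrite /above_choices ?orbT.
  - case: (posnP i) => [-> | i0].
      by apply: (sum1 _ _ 0%N) => [//|v|]; rewrite /above_choices ?orbT.
    apply: (sum1 _ _ i) => [//|v|]; last by rewrite eqxx !orbT.
    by rewrite /above_choices -[i == _]leqn0 leqNgt i0 /= eqxx.
  case: (posnP i) => [-> | i0].
    by apply: (sum1 _ _ 0%N) => [//|v|]; rewrite /above_choices ?orbT.
  apply: (sum1 _ _ i) => [//|v|]; last by rewrite eqxx !orbT.
  rewrite /above_choices -[i == 0%N]leqn0 leqNgt i0 /= eqxx.
  by case: eqP => [->|].
rewrite -(sum_choices K L.+2 (above_choices L g) G) mulr_suml.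
have choicesE (h : height K L.+2) :
    asm_height L.+2 (hval h) && interlace L.+1 g (hval h)
  = [forall p : 'I_L.+3, forall q : 'I_L.+3, above_choices L g p q (hval h p q)].
  (* The unit steps follow from interlacing; the remaining conditions are independent choices. *)
  transitivity (asm_border L.+2 (hval h) && interlace L.+1 g (hval h)).
    apply/andP/andP => -[ah gh]; split=> //; first by case/andP: ah.
    exact: interlace_above gh.
  apply/above_choicesP/forallP => // [ok P | ok P Q PL QL].
    by apply/forallP => Q; apply: ok; rewrite -ltnS.
  by have /forallP/(_ (Ordinal (QL : (Q < L.+3)%N))) :=
    ok (Ordinal (PL : (P < L.+3)%N)).
apply: eq_big => [h | h /andP[/andP[bh _] gh]]; first exact: choicesE.
rewrite (pair_weight_above _ _ bg bh) (sqprod_above ag bh gh y0) mulrA; congr (_ * _).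
rewrite -sqprodM [RHS]sqprod_inner => [|i iL]; last first.
  by rewrite /G !eqxx !orbT.
by apply: eq_sqprod => p q pL qL; rewrite Ginner.
Qed.

End SumAbove.

(** * Six-vertex types of the cells *)

(** The corner values of a unit cell relative to the upper left one, [c]. The partial sums r and s
    of the six-vertex types are [h11 - h01] and [h11 - h10]. *)
Variant cell_spec (c h01 h10 h11 : nat) : vertex_type -> Prop :=
| CellA1 of h01 = c & h10 = c & h11 = c : cell_spec c h01 h10 h11 Va1
| CellA2 of h01 = c.+1 & h10 = c.+1 & h11 = c.+2 : cell_spec c h01 h10 h11 Va2
| CellB1 of h01 = c.+1 & h10 = c & h11 = c.+1 : cell_spec c h01 h10 h11 Vb1
| CellB2 of h01 = c & h10 = c.+1 & h11 = c.+1 : cell_spec c h01 h10 h11 Vb2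
| CellC1 of h01 = c & h10 = c & h11 = c.+1 : cell_spec c h01 h10 h11 Vc1
| CellC2 of h01 = c.+1 & h10 = c.+1 & h11 = c.+1 : cell_spec c h01 h10 h11 Vc2.

Lemma cell_type L (h : nat -> nat -> nat) p q :
    asm_height L.+1 h -> (p < L.+1)%N -> (q < L.+1)%N ->
  {t | cell_spec (h p q) (h p q.+1) (h p.+1 q) (h p.+1 q.+1) t}.
Proof.
move=> hh pL qL; have /unit_stepsP sh := proj2 (andP hh).
have [s1 s2 _ _] := sh p q (ltnW pL) qL; have [s3 s4 _ _] := sh p.+1 q pL qL.
have [_ _ s5 s6] := sh q p (ltnW qL) pL; have [_ _ s7 s8] := sh q.+1 p qL pL.
have [e1 | n1] := eqVneq (h p q.+1) (h p q);
have [e2 | n2] := eqVneq (h p.+1 q) (h p q).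
- have [e3 | n3] := eqVneq (h p.+1 q.+1) (h p q).
    by exists Va1; constructor.
  by exists Vc1; constructor=> //; lia.
- by exists Vb2; constructor=> //; lia.
- by exists Vb1; constructor=> //; lia.
have [e3 | n3] := eqVneq (h p.+1 q.+1) (h p q).+1.
  by exists Vc2; constructor; lia.
by exists Va2; constructor; lia.
Qed.

Lemma mixed_diffE (h : nat -> nat -> nat) p q t :
    cell_spec (h p q) (h p q.+1) (h p.+1 q) (h p.+1 q.+1) t ->
  mixed_diff h p q = match t with Vc1 => 1 | Vc2 => -1 | _ => 0 end.
Proof. by case=> e1 e2 e3; rewrite /mixed_diff e1 e2 e3; lia. Qed.

Lemma sum_single (R : nmodType) K (P : pred nat) (f : nat -> R) (u : nat) :
  (u <= K)%N -> P =1 pred1 u -> \sum_(v < K.+1 | P v) f v = f u.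
Proof.
by move=> uK Pu; rewrite (big_pred1 (Ordinal (uK : (u < K.+1)%N))) // => v; rewrite Pu.
Qed.

Lemma sum_pair (R : nmodType) K (P : pred nat) (f : nat -> R) (u : nat) :
    (u < K)%N -> P =1 (fun v => (v == u) || (v == u.+1)) ->
  \sum_(v < K.+1 | P v) f v = f u + f u.+1.
Proof.
move=> uK Pu; rewrite (bigD1 (Ordinal (ltnW uK : (u < K.+1)%N))) ?Pu ?eqxx //=.
congr (_ + _).
rewrite (big_pred1 (Ordinal (uK : (u.+1 < K.+1)%N))) // => v.
rewrite Pu /= -!(inj_eq val_inj) /=; case: (eqVneq (v : nat) u) => [->|_] /=.
  by lia.
by rewrite andbT.
Qed.

(** * Local sums by six-vertex type *)

Section Cells.

Variables (F : fieldType) (K L : nat) (h : nat -> nat -> nat) (p q : nat).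
Hypotheses (hh : asm_height L.+1 h) (pL : (p < L.+1)%N) (qL : (q < L.+1)%N).
Hypothesis LK : (L.+1 <= K)%N.

Lemma cell_bound : (h p.+1 q.+1 <= K)%N.
Proof. by have := asm_height_le hh pL qL; lia. Qed.

Variables (l m y : nat -> nat -> F).
Let a := y p q * y p.+1 q.+1.
Let b := y p q.+1 * y p.+1 q.

Lemma below_sum1 u (e1 e2 : nat) :
    (u <= K)%N -> cell_lo h p q = u -> cell_hi h p q = u ->
    (u.+1 - h p.+1 q.+1 = e1)%N -> (h p q.+1 - u = e2)%N ->
  below_sum K l m y h p q = l p q ^+ e1 * m p q ^+ e2.
Proof.
move=> uK lo hi <- <-; rewrite /below_sum lo hi.
rewrite (@sum_single _ K (fun v => u <= v <= u)%N
  (below_term (l p q) (m p q) a b h p q) u) // => [|v]; last by rewrite /=; lia.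
by rewrite /below_term lo hi subnn !expr0 !mulr1.
Qed.

Lemma below_sum2 u :
    (u < K)%N -> cell_lo h p q = u -> cell_hi h p q = u.+1 ->
    h p.+1 q.+1 = u.+1 -> h p q.+1 = u.+1 ->
  below_sum K l m y h p q = m p q * a + l p q * b.
Proof.
move=> uK lo hi e1 e2; rewrite /below_sum lo hi.
rewrite (@sum_pair _ K (fun v => u <= v <= u.+1)%N
  (below_term (l p q) (m p q) a b h p q) u) // => [|v]; last by rewrite /=; lia.
rewrite /below_term lo hi e1 e2 !subnn !subSnn !expr0 !expr1.
by ring.
Qed.

Lemma above_sum1 u (e1 e2 : nat) :
    (u <= K)%N -> vertex_lo h p q = u -> vertex_hi h p q = u ->
    ((h p q).+1 - u = e1)%N -> (u - h p.+1 q = e2)%N ->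
  above_sum K l m y h p q = l p q ^+ e1 * m p q ^+ e2.
Proof.
move=> uK lo hi <- <-; rewrite /above_sum lo hi.
rewrite (@sum_single _ K (fun v => u <= v <= u)%N
  (above_term (l p q) (m p q) a b h p q) u) // => [|v]; last by rewrite /=; lia.
by rewrite /above_term lo hi subnn !expr0 !mulr1.
Qed.

Lemma above_sum2 u :
    (u < K)%N -> vertex_lo h p q = u -> vertex_hi h p q = u.+1 ->
    h p q = u -> h p.+1 q = u ->
  above_sum K l m y h p q = m p q * a + l p q * b.
Proof.
move=> uK lo hi e1 e2; rewrite /above_sum lo hi.
rewrite (@sum_pair _ K (fun v => u <= v <= u.+1)%N
  (above_term (l p q) (m p q) a b h p q) u) // => [|v]; last by rewrite /=; lia.
rewrite /above_term lo hi e1 e2 !subnn !subSnn !expr0 !expr1.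
by ring.
Qed.

(** Two values are admissible only in type c2, where [a] and [b] survive; elsewhere one monomial
    remains. *)
Lemma below_sumE t :
    cell_spec (h p q) (h p q.+1) (h p.+1 q) (h p.+1 q.+1) t ->
  below_sum K l m y h p q = match t with
    | Va1 => l p q | Vb1 => m p q | Vc2 => m p q * a + l p q * b | _ => 1 end.
Proof.
have hK := cell_bound.
case=> e1 e2 e3.
- by rewrite (@below_sum1 (h p q) 1 0) ?mulr1 // /cell_lo /cell_hi; lia.
- by rewrite (@below_sum1 (h p q).+1 0 0) ?mulr1 // /cell_lo /cell_hi; lia.
- by rewrite (@below_sum1 (h p q) 0 1) ?mul1r // /cell_lo /cell_hi; lia.
- by rewrite (@below_sum1 (h p q) 0 0) ?mulr1 // /cell_lo /cell_hi; lia.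
- by rewrite (@below_sum1 (h p q) 0 0) ?mulr1 // /cell_lo /cell_hi; lia.
by rewrite (@below_sum2 (h p q)) // /cell_lo /cell_hi; lia.
Qed.

(** Dually, only type c1 leaves two values above. *)
Lemma above_sumE t :
    cell_spec (h p q) (h p q.+1) (h p.+1 q) (h p.+1 q.+1) t ->
  above_sum K l m y h p q = match t with
    | Va1 => l p q | Vb1 => m p q | Vc1 => m p q * a + l p q * b | _ => 1 end.
Proof.
have hK := cell_bound.
case=> e1 e2 e3.
- by rewrite (@above_sum1 (h p q) 1 0) ?mulr1 // /vertex_lo /vertex_hi; lia.
- by rewrite (@above_sum1 (h p q).+1 0 0) ?mulr1 // /vertex_lo /vertex_hi; lia.
- by rewrite (@above_sum1 (h p q).+1 0 1) ?mul1r // /vertex_lo /vertex_hi; lia.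
- by rewrite (@above_sum1 (h p q).+1 0 0) ?mulr1 // /vertex_lo /vertex_hi; lia.
- by rewrite (@above_sum2 (h p q)) // /vertex_lo /vertex_hi; lia.
by rewrite (@above_sum1 (h p q).+1 0 0) ?mulr1 // /vertex_lo /vertex_hi; lia.
Qed.

(** The two local sums differ only at types c1 and c2, by the numerator of the recursion: for c1 its
    quotient by [z] is [x], for c2 its quotient by [x] is [z]. *)
Lemma cell_exchange (x z : F) :
    x = (m p q * a + l p q * b) / z -> (mixed_diff h p q = -1 -> x != 0) ->
  below_sum K l m y h p q * x ^ mixed_diff h p q
  = z ^ (- mixed_diff h p q) * above_sum K l m y h p q.
Proof.
have [t ht] := cell_type hh pL qL.
rewrite (below_sumE ht) (above_sumE ht) (mixed_diffE ht).
move=> -> x0; case: t ht x0 => _ x0; rewrite ?oppr0 ?opprK ?expr0z ?mulr1 ?mul1r //.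
  by rewrite expr1z exprN1 mulrC.
have := x0 erefl; rewrite mulf_eq0 negb_or exprN1 => /andP[s0 _].
by rewrite expr1z invf_div mulrCA mulfV ?mulr1.
Qed.

End Cells.

(** * Condensation *)

Lemma hval_inj K N (f g : height K N) :
    (forall p q, (p <= N)%N -> (q <= N)%N -> hval f p q = hval g p q) ->
  f = g.
Proof.
move=> fg; apply/ffunP => -[p q]; apply: val_inj.
by have := fg p q; rewrite /hval !inord_val; apply; rewrite -ltnS.
Qed.

(** In a border row or column the mixed difference is a step of [h], or 1 minus such a step, hence
    nonnegative. *)
Lemma mixed_diff_inner L h p q :
    asm_height L.+1 h -> (p <= L)%N -> (q <= L)%N -> mixed_diff h p q = -1 ->
  (0 < p < L)%N && (0 < q < L)%N.
Proof.
case/andP=> /asm_borderP bh /unit_stepsP sh pL qL hpq.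
have [s1 s2 _ _] := sh p q (leqW pL) qL; have [s3 s4 _ _] := sh p.+1 q pL qL.
have [_ _ s5 s6] := sh q p (leqW qL) pL; have [_ _ s7 s8] := sh q.+1 p qL pL.
have [p1 p2 p3 p4] := bh p (leqW pL); have [p5 p6 p7 p8] := bh p.+1 pL.
have [q1 q2 q3 q4] := bh q (leqW qL); have [q5 q6 q7 q8] := bh q.+1 qL.
move: hpq; rewrite /mixed_diff.
have [p0 | p0] := posnP p; first by rewrite p0 in s3 s4 *; lia.
have [q0 | q0] := posnP q; first by rewrite q0 in s7 s8 *; lia.
have [pL1 | pL1] := ltnP p L; last first.
  have pE : p = L by lia.
  by rewrite pE in s1 s2 *; lia.
have [qL1 | qL1] := ltnP q L; last first.
  have qE : q = L by lia.
  by rewrite qE in s5 s6 *; lia.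
by [].
Qed.

Section Condensation.

Variables (F : fieldType) (n : nat) (A : 'M[F]_n) (lam mu : int -> F).
Hypothesis dA : lambda_det_defined A lam mu.
Implicit Types (k N L p q : nat).

(* The values [T_{i,j,k}] of the cone form, at level [k], a square of side
   [n - k + 1]; [p] and [q] are its row and column, counted from 0. *)
Definition cone_value k p q : F :=
  lambdaT A lam mu (q%:Z - p%:Z) (p%:Z + q%:Z + k%:Z - n%:Z) k.

Definition lcoef p q : F := lam (q%:Z - p%:Z).
Definition mcoef N p q : F := mu (p%:Z + q%:Z - N%:Z).

(** In these coordinates |i| + |j| is the larger of |2p + k - n| and |2q + k - n|, so inner
    positions satisfy the bound of [lambda_det_defined]. *)
Lemma cone_value_neq0 k p q :
    (0 < p)%N -> (p + k < n)%N -> (0 < q)%N -> (q + k < n)%N ->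
  cone_value k p q != 0.
Proof. by move=> p0 pn q0 qn; apply: dA; lia. Qed.

(** The neighbours j - 1, j + 1 are the diagonal corners of the cell (p, q), and i - 1, i + 1 its
    antidiagonal ones. *)
Lemma cone_value_rec k L p q :
    n = (L + k).+2 ->
  cone_value k.+2 p q =
    (mcoef L p q * (cone_value k.+1 p q * cone_value k.+1 p.+1 q.+1)
     + lcoef p q * (cone_value k.+1 p q.+1 * cone_value k.+1 p.+1 q))
    / cone_value k p.+1 q.+1.
Proof.
move=> nE; rewrite {1}/cone_value.
have -> i j : lambdaT A lam mu i j k.+2 =
   (mu j * lambdaT A lam mu i (j + 1) k.+1 * lambdaT A lam mu i (j - 1) k.+1
    + lam i * lambdaT A lam mu (i + 1) j k.+1 * lambdaT A lam mu (i - 1) j k.+1)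
   / lambdaT A lam mu i j k by [].
rewrite -!mulrA.
congr (_ / _); last by rewrite /cone_value; congr lambdaT; lia.
congr (_ + _); congr (_ * _).
- by rewrite /mcoef; congr mu; lia.
- rewrite mulrC /cone_value; congr (_ * _); congr lambdaT; lia.
- by rewrite /cone_value; congr (_ * _); congr lambdaT; lia.
Qed.

(** Meant for [n = (N + k).+1]. Level [k] enters only at its inner positions, where its values are
    nonzero. *)
Definition pair_sum k N : F :=
  \sum_(h : height n N | asm_height N (hval h))
    \sum_(g : height n N.+1 |
           asm_height N.+1 (hval g) && interlace N (hval h) (hval g))
      pair_weight N lcoef (mcoef N) (hval h) (hval g)
      * sqprod N
          (fun p q => cone_value k p.+1 q.+1 ^ (- mixed_diff (hval h) p q))
      * sqprod N.+1 (fun p q => cone_value k.+1 p q ^ mixed_diff (hval g) p q).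

(** After exchanging the sums, the powers of level [k.+1] factor out, and whatever interlaces below
    [g] is automatically a height. *)
Lemma pair_sum_below k L :
    (L + k < n)%N ->
  pair_sum k L =
    \sum_(g : height n L.+1 | asm_height L.+1 (hval g))
      sqprod L.+1 (fun p q =>
        below_sum n lcoef (mcoef L) (cone_value k) (hval g) p q
        * cone_value k.+1 p q ^ mixed_diff (hval g) p q)
      * sqprod L (fun p q => cone_value k p.+1 q.+1 ^ residual (hval g) p q).
Proof.
move=> Lk; rewrite /pair_sum.
rewrite (exchange_big_dep
  (fun g : height n L.+1 => asm_height L.+1 (hval g))) /=; last first.
  by move=> h g _ /andP[].
apply: eq_bigr => g ag.
rewrite -mulr_suml.
rewrite (eq_bigl (fun h : height n L => interlace L (hval h) (hval g))); last first.
  move=> h; rewrite ag /= andbC; case: (boolP (interlace _ _ _)) => //= gh.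
  exact: interlace_below gh.
rewrite sum_below // => [|p q pL qL]; last by apply: cone_value_neq0; lia.
by rewrite sqprodM mulrAC.
Qed.

(** The common height [h] is the larger one of the pairs on the left and the smaller one on the
    right. The residual factors agree, and [cell_exchange] matches the local ones. *)
Lemma pair_sum_step k L : n = (L + k).+2 -> pair_sum k.+1 L = pair_sum k L.+1.
Proof.
move=> nE; rewrite pair_sum_below; last by lia.
apply: eq_bigr => h ah.
under [RHS]eq_bigr do rewrite mulrAC.
rewrite -mulr_suml sum_above //; [| lia |]; last first.
  by move=> p q pL qL; apply: cone_value_neq0; lia.
rewrite mulrAC -sqprodM; congr (_ * _); apply: eq_sqprod => p q pL qL.
rewrite [RHS]mulrC.
(* The row shift of [m] compensates the change of size in [mcoef]. *)
have -> : above_sum n lcoef (fun p q => mcoef L.+1 p.+1 q) (cone_value k.+1)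
      (hval h) p q
    = above_sum n lcoef (mcoef L) (cone_value k.+1) (hval h) p q.
  apply: eq_bigr => v _; congr above_term.
  by rewrite /mcoef; congr mu; lia.
apply: (cell_exchange ah pL qL); first lia.
  exact: cone_value_rec.
(* Only an entry -1 requires a nonzero value of level [k.+2], and such entries are inner. *)
move/(mixed_diff_inner ah pL qL) => inner.
by apply: cone_value_neq0; lia.
Qed.

(** A single pair remains, [h0] for the empty matrix and [g0] for the matrix (1), and its monomial
    is the last value of the cone. *)
Lemma pair_sum_base k : n = k.+1 -> pair_sum k 0 = cone_value k.+1 0 0.
Proof.
move=> nE; have n1 : (1 < n.+1)%N by lia.
pose g0 : height n 1 := [ffun ij : 'I_2 * 'I_2 => inord (ij.1 * ij.2)%N].
pose h0 : height n 0 := [ffun _ : 'I_1 * 'I_1 => ord0].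
have g0E p q : (p <= 1)%N -> (q <= 1)%N -> hval g0 p q = (p * q)%N.
  move=> p1 q1; rewrite /hval ffunE /= !inordK //.
  by case: p q p1 q1 => [|[]] // [|[]].
have h0E p q : hval h0 p q = 0%N by rewrite /hval ffunE.
rewrite /pair_sum (big_pred1 h0) => [|h]; last first.
  apply/idP/eqP => [/andP[/asm_borderP bh _] | ->].
    apply: hval_inj => p q; rewrite !leqn0 => /eqP-> /eqP->.
    by have [-> _ _ _] := bh 0%N isT; rewrite h0E.
  apply/andP; split; last by apply/unit_stepsP.
  by apply/asm_borderP => i; rewrite leqn0 => /eqP->; rewrite h0E.
rewrite (big_pred1 g0) => [|g]; last first.
  apply/idP/eqP => [/andP[/andP[/asm_borderP bg _] _] | ->].
    have [b1 b2 b3 b4] := bg 0%N isT; have [b5 b6 b7 b8] := bg 1%N isT.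
    by apply: hval_inj => -[|[|p]] [|[|q]] // _ _; rewrite g0E.
  have bg : asm_border 1 (hval g0).
    by apply/asm_borderP => -[|[|i]] // _; rewrite !g0E.
  suff gh : interlace 0 (hval h0) (hval g0) by rewrite (interlace_above bg gh).
  apply/interlaceP => p q; rewrite !leqn0 => /eqP-> /eqP->.
  by rewrite h0E /cell_lo /cell_hi !g0E.
rewrite /pair_weight /sqprod !big_ord1 !big_ord0 /mixed_diff !g0E // h0E.
by rewrite !expr0 !mul1r.
Qed.

(** Descend from level [L], with its single pair, to level 0, where all values are 1 and the
    residual factors disappear. *)
Lemma lambda_det_heights L :
    n = L.+1 ->
  lambda_det A lam mu =
    \sum_(g : height n L.+1 | asm_height L.+1 (hval g))
      sqprod L.+1 (fun p q =>
        below_sum n lcoef (mcoef L) (fun _ _ => 1) (hval g) p q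
        * cone_value 1 p q ^ mixed_diff (hval g) p q).
Proof.
move=> nE.
have -> : lambda_det A lam mu = pair_sum 0 L.
  have step k N : n = (N + k).+1 -> pair_sum k N = pair_sum 0 (N + k).
    elim: k N => [|k IHk] N nE'; first by rewrite addn0.
    rewrite pair_sum_step; last by lia.
    by rewrite IHk ?addSnnS //; lia.
  rewrite -[L]add0n -step // pair_sum_base // /lambda_det /cone_value -nE.
  by congr lambdaT; lia.
rewrite pair_sum_below; last by lia.
apply: eq_bigr => g _; rewrite [X in _ * X]sqprod1 ?mulr1 //.
by move=> p q _ _; rewrite /cone_value exp1rz.
Qed.

End Condensation.

(** * Alternating sign matrices and heights *)

Section Alternation.

Let partial (f : nat -> int) k : int := \sum_(0 <= j < k) f j.

Fixpoint walk01 (b : int) (s : seq int) : bool :=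
  if s is x :: s' then (0 <= b + x <= 1) && walk01 (b + x) s' else b == 1.

Lemma alternating_walk (s : seq int) :
  all [in sign_values] s -> alternating s = walk01 0 s.
Proof.
(* Generalized to a start at partial sum [b]: then [b + b - 1] is the last nonzero sign read, a
   virtual -1 standing before the whole sequence. *)
have walkE (b : int) (t : seq int) : (b == 0) || (b == 1) ->
    all [in sign_values] t ->
    path (fun x y => y == - x) (b + b - 1) [seq x <- t | x != 0]
    && (last (b + b - 1) [seq x <- t | x != 0] == 1) = walk01 b t.
  elim: t b => [|x t IHt] b hb /=; first by move: hb; lia.
  rewrite !inE => /andP[/or3P[]/eqP-> ht] /=.
  - by rewrite addr0 IHt //; move: hb => /orP[]/eqP->.
  - by case/orP: hb => /eqP-> //=; rewrite -IHt.
  by case/orP: hb => /eqP-> //=; rewrite -IHt.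
move=> hs; rewrite -walkE // /alternating.
case: [seq x <- s | x != 0] => //= x t.
by rewrite (_ : - (0 + 0 - 1) = 1) // -andbA [path _ _ _ && _]andbC.
Qed.

Lemma alternatingP (f : nat -> int) N :
    (forall j, (j < N)%N -> f j \in sign_values) ->
  reflect ((forall k, (k <= N)%N -> 0 <= partial f k <= 1) /\ partial f N = 1)
          (alternating [seq f j | j <- iota 0 N]).
Proof.
move=> hf; rewrite alternating_walk; last first.
  by apply/allP => x /mapP[j]; rewrite mem_iota => /andP[_ jN] ->; apply: hf.
have walkP i m : reflect ((forall k, (i < k <= i + m)%N -> 0 <= partial f k <= 1)
    /\ partial f (i + m) = 1) (walk01 (partial f i) [seq f j | j <- iota i m]).
  elim: m i => [|m IHm] i /=.
    rewrite addn0; apply: (iffP eqP) => [-> | [] //]; split=> // k; lia.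
  have -> : partial f i + f i = partial f i.+1 by rewrite /partial big_nat_recr.
  rewrite addnS -addSn; apply: (iffP andP) => [[h1 /IHm[h2 h3]] | [h1 h2]].
    split=> // k ik; have [->//|ne] := eqVneq k i.+1; apply: h2; lia.
  split; first by apply: h1; lia.
  by apply/IHm; split=> // k ik; apply: h1; lia.
have p0 : partial f 0 = 0 by rewrite /partial big_geq.
have := walkP 0%N N; rewrite p0 add0n => wP.
apply: (iffP wP) => -[h1 h2]; split=> // k kN.
  by case: (posnP k) => [-> | k0]; [rewrite p0 | apply: h1; rewrite k0].
by apply: h1; case/andP: kN.
Qed.

End Alternation.

(** * The bijection by corner sums *)

Section HeightMatrices.

Variables (K L : nat).
Local Notation N := L.+1.
Implicit Types (B : 'M[sign_entry]_N) (g : height K N).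

Definition bval B (i j : nat) : int := sign_int (B (inord i) (inord j)).

Definition corner_sum B p q : int :=
  \sum_(0 <= i < p) \sum_(0 <= j < q) bval B i j.

(** The default for other integers is 0; it never occurs for the mixed differences of heights. *)
Definition sign_of (x : int) : sign_entry :=
  insubd (SeqSub (mem_head 0 [:: 1; -1])) x.

Definition matrix_of_height g : 'M[sign_entry]_N :=
  \matrix_(i, j) sign_of (mixed_diff (hval g) i j).

(** For an alternating sign matrix and [L.+1 <= K], the absolute value and [inord] lose nothing, as
    corner sums lie between 0 and [K]. *)
Definition height_of_matrix B : height K N :=
  [ffun ij : 'I_N.+1 * 'I_N.+1 => inord `|corner_sum B ij.1 ij.2|%N].

Lemma bval_sign B i j : bval B i j \in sign_values.
Proof. exact: valP. Qed.

Lemma is_asmP B :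
  reflect (forall i, (i < N)%N ->
            [/\ forall k, (k <= N)%N -> 0 <= \sum_(0 <= j < k) bval B i j <= 1,
                \sum_(0 <= j < N) bval B i j = 1,
                forall k, (k <= N)%N -> 0 <= \sum_(0 <= j < k) bval B j i <= 1
              & \sum_(0 <= j < N) bval B j i = 1])
          (is_asm B).
Proof.
have rowE (i : 'I_N) : [seq sign_int (B i j) | j <- enum 'I_N]
    = [seq bval B i j | j <- iota 0 N].
  rewrite -val_enum_ord -map_comp; apply: eq_map => j /=.
  by rewrite /bval !inord_val.
have colE (j : 'I_N) : [seq sign_int (B i j) | i <- enum 'I_N]
    = [seq bval B i j | i <- iota 0 N].
  rewrite -val_enum_ord -map_comp; apply: eq_map => i /=.
  by rewrite /bval !inord_val.
apply: (iffP andP) => [[/forallP rB /forallP cB] i iN | aB].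
  have := rB (Ordinal iN); rewrite rowE => /alternatingP[|? ?].
    by move=> j _; apply: bval_sign.
  have := cB (Ordinal iN); rewrite colE.
  case/(alternatingP (f := fun j => bval B j i)) => [|? ?].
    by move=> j _; apply: bval_sign.
  by split.
split; apply/forallP => i; have [r1 r2 c1 c2] := aB i (ltn_ord i).
  by rewrite rowE; apply/alternatingP => // j _; apply: bval_sign.
rewrite colE; apply/(alternatingP (f := fun j => bval B j i)) => // j _.
exact: bval_sign.
Qed.

Lemma matrix_of_heightE g p q : asm_height N (hval g) -> (p < N)%N -> (q < N)%N ->
  bval (matrix_of_height g) p q = mixed_diff (hval g) p q.
Proof.
move=> ag pN qN; rewrite /bval mxE /sign_int /sign_of insubdK !inordK //.
have [t ht] := cell_type ag pN qN.
by rewrite unfold_in (mixed_diffE ht); case: t {ht}.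
Qed.

Lemma sum_matrix_of_height g p q :
    asm_height N (hval g) -> (p < N)%N -> (q <= N)%N ->
  \sum_(0 <= j < q) bval (matrix_of_height g) p j
  = (hval g p.+1 q)%:Z - (hval g p q)%:Z.
Proof.
move=> ag pN; have /asm_borderP bg := proj1 (andP ag).
elim: q => [|q IHq] qN.
  have [_ -> _ _] := bg _ pN; have [_ -> _ _] := bg _ (ltnW pN).
  by rewrite big_geq.
by rewrite big_nat_recr //= IHq ?(ltnW qN) // matrix_of_heightE // /mixed_diff; lia.
Qed.

Lemma sum_matrix_of_heightC g p q :
    asm_height N (hval g) -> (p <= N)%N -> (q < N)%N ->
  \sum_(0 <= i < p) bval (matrix_of_height g) i q
  = (hval g p q.+1)%:Z - (hval g p q)%:Z.
Proof.
move=> ag + qN; have /asm_borderP bg := proj1 (andP ag).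
elim: p => [|p IHp] pN.
  have [-> _ _ _] := bg _ qN; have [-> _ _ _] := bg _ (ltnW qN).
  by rewrite big_geq.
by rewrite big_nat_recr //= IHp ?(ltnW pN) // matrix_of_heightE // /mixed_diff; lia.
Qed.

(** Partial sums of rows and columns are steps of the height, hence 0 or 1; full sums are 1 by the
    border values. *)
Lemma matrix_of_height_asm g : asm_height N (hval g) -> is_asm (matrix_of_height g).
Proof.
move=> ag; have /andP[/asm_borderP bg /unit_stepsP sg] := ag.
apply/is_asmP => i iN.
have [_ _ n1 n2] := bg _ iN; have [_ _ n3 n4] := bg _ (ltnW iN).
split=> [k kN||k kN|].
- by rewrite sum_matrix_of_height //; have [] := sg k i kN iN; lia.
- by rewrite sum_matrix_of_height //; lia.
- by rewrite sum_matrix_of_heightC //; have [] := sg k i kN iN; lia.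
by rewrite sum_matrix_of_heightC //; lia.
Qed.

Lemma vertex_matrix_of_height g t (i j : 'I_N) :
    asm_height N (hval g) ->
    cell_spec (hval g i j) (hval g i j.+1) (hval g i.+1 j) (hval g i.+1 j.+1) t ->
  vertex (matrix_of_height g) i j = t.
Proof.
move=> ag ht.
have iN := ltn_ord i; have jN := ltn_ord j.
have BE : sign_int (matrix_of_height g i j) = mixed_diff (hval g) i j.
  by rewrite -matrix_of_heightE // /bval !inord_val.
have rE : \sum_(k < N | (k <= j)%N) sign_int (matrix_of_height g i k)
    = (hval g i.+1 j.+1)%:Z - (hval g i j.+1)%:Z.
  rewrite -sum_matrix_of_height // big_mkord.
  rewrite (big_ord_widen N (bval (matrix_of_height g) i)) //.
  by apply: eq_bigr => k _; rewrite /bval !inord_val.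
have sE : \sum_(k < N | (k <= i)%N) sign_int (matrix_of_height g k j)
    = (hval g i.+1 j.+1)%:Z - (hval g i.+1 j)%:Z.
  rewrite -sum_matrix_of_heightC // big_mkord.
  rewrite (big_ord_widen N (fun k => bval (matrix_of_height g) k j)) //.
  by apply: eq_bigr => k _; rewrite /bval !inord_val.
rewrite /vertex BE rE sE (mixed_diffE ht).
by case: ht => -> -> -> //=;
  rewrite !subr_eq0 !eqz_nat ?eqSS ?eqxx ?(gtn_eqF (ltnSn _)).
Qed.

Lemma corner_sumC B p q :
  corner_sum B p q = \sum_(0 <= j < q) \sum_(0 <= i < p) bval B i j.
Proof. exact: exchange_big_nat. Qed.

Lemma corner_sumS B p q :
  corner_sum B p.+1 q = corner_sum B p q + \sum_(0 <= j < q) bval B p j.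
Proof. exact: big_nat_recr. Qed.

Lemma corner_sumSr B p q :
  corner_sum B p q.+1 = corner_sum B p q + \sum_(0 <= i < p) bval B i q.
Proof. by rewrite !corner_sumC big_nat_recr. Qed.

Lemma corner_sum_diff B p q :
  corner_sum B p.+1 q.+1 + corner_sum B p q - corner_sum B p q.+1 - corner_sum B p.+1 q
  = bval B p q.
Proof.
rewrite !corner_sumS big_nat_recr //=.
by ring.
Qed.

Lemma corner_sum_asm B : is_asm B ->
  [/\ forall p q, (p < N)%N -> (q <= N)%N ->
        corner_sum B p q <= corner_sum B p.+1 q <= corner_sum B p q + 1,
      forall p q, (p <= N)%N -> (q < N)%N ->
        corner_sum B p q <= corner_sum B p q.+1 <= corner_sum B p q + 1,
      forall i, (i <= N)%N -> corner_sum B N i = i%:Z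
    & forall i, (i <= N)%N -> corner_sum B i N = i%:Z].
Proof.
move=> /is_asmP aB; split=> [p q pN qN | p q pN qN | i iN | i iN].
- have [r1 _ _ _] := aB p pN; have := r1 q qN.
  by rewrite corner_sumS; lia.
- have [_ _ c1 _] := aB q qN; have := c1 p pN.
  by rewrite corner_sumSr; lia.
- rewrite corner_sumC (eq_big_nat _ _ (F2 := fun=> 1)).
    by rewrite big_const_nat iter_addr_0 subn0 natz.
  by move=> j /andP[_ ji]; have [_ _ _ ->] := aB j (leq_trans ji iN).
rewrite /corner_sum (eq_big_nat _ _ (F2 := fun=> 1)).
  by rewrite big_const_nat iter_addr_0 subn0 natz.
by move=> j /andP[_ ji]; have [_ -> _ _] := aB j (leq_trans ji iN).
Qed.

Lemma corner_sum_bounds B p q : is_asm B -> (p <= N)%N -> (q <= N)%N ->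
  0 <= corner_sum B p q <= p%:Z.
Proof.
case/corner_sum_asm=> rB _ _ _; elim: p => [|p IHp] pN qN.
  by rewrite /corner_sum big_geq.
have := IHp (ltnW pN) qN; have := rB p q pN qN; lia.
Qed.

Hypothesis LK : (L.+1 <= K)%N.

Lemma height_of_matrixE B p q : is_asm B -> (p <= N)%N -> (q <= N)%N ->
  (hval (height_of_matrix B) p q)%:Z = corner_sum B p q.
Proof.
move=> aB pN qN; have := corner_sum_bounds aB pN qN.
rewrite /hval ffunE /= !(@inordK L.+1) // => bd.
by rewrite inordK; lia.
Qed.

Lemma asm_height_of_matrix B : is_asm B -> asm_height N (hval (height_of_matrix B)).
Proof.
move=> aB; have [rB cB eB fB] := corner_sum_asm aB.
have hE := height_of_matrixE aB.
apply/andP; split.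
  apply/asm_borderP => i iN.
  have e1 := hE 0%N i isT iN; have e2 := hE i 0%N iN isT.
  have e3 := hE N i (leqnn _) iN; have e4 := hE i N iN (leqnn _).
  rewrite /corner_sum big_geq // in e1; rewrite corner_sumC big_geq // in e2.
  by rewrite eB // in e3; rewrite fB // in e4; split; lia.
apply/unit_stepsP => p q pN qN; have := rB q p qN pN; have := cB p q pN qN.
rewrite -!hE //; try lia.
by move=> ? ?; split; lia.
Qed.

Lemma matrix_of_heightK g : asm_height N (hval g) ->
  height_of_matrix (matrix_of_height g) = g.
Proof.
move=> ag; apply: hval_inj => p q pN qN.
suff : (hval (height_of_matrix (matrix_of_height g)) p q)%:Z = (hval g p q)%:Z by case.
rewrite height_of_matrixE ?matrix_of_height_asm //.
have /asm_borderP bg := proj1 (andP ag).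
elim: p pN => [|p IHp] pN.
  by have [-> _ _ _] := bg _ qN; rewrite /corner_sum big_geq.
rewrite corner_sumS IHp ?(ltnW pN) //.
by rewrite sum_matrix_of_height //; lia.
Qed.

Lemma height_of_matrixK B : is_asm B -> matrix_of_height (height_of_matrix B) = B.
Proof.
move=> aB; apply/matrixP => i j; apply: val_inj.
have := matrix_of_heightE (asm_height_of_matrix aB) (ltn_ord i) (ltn_ord j).
rewrite /bval !inord_val /sign_int => ->.
rewrite /mixed_diff !height_of_matrixE //; try by [apply: ltnW].
by rewrite corner_sum_diff /bval !inord_val.
Qed.

Lemma sum_asm_heights (R : nmodType) (f : 'M[sign_entry]_N -> R) :
  \sum_(B | is_asm B) f B
  = \sum_(g : height K N | asm_height N (hval g)) f (matrix_of_height g).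
Proof.
rewrite (reindex_onto matrix_of_height height_of_matrix height_of_matrixK).
apply: eq_bigl => g; apply/andP/idP => [[aB /eqP <-] | ag].
  exact: asm_height_of_matrix.
by rewrite matrix_of_height_asm // matrix_of_heightK.
Qed.

End HeightMatrices.

(** * Matrix entries at level 1 and the six-vertex weights *)

Lemma cone_value1 (F : fieldType) n (A : 'M[F]_n) lam mu (i j : 'I_n) :
  cone_value A lam mu 1 i j = A i j.
Proof.
rewrite /cone_value /=.
have -> : ((i%:Z + j%:Z + 1 - n%:Z - (j%:Z - i%:Z) + n%:Z + 1) %/ 2)%Z
  = i.+1%:Z by lia.
have -> : ((j%:Z - i%:Z + (i%:Z + j%:Z + 1 - n%:Z) + n%:Z + 1) %/ 2)%Z
  = j.+1%:Z by lia.
by rewrite /entry !valK.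
Qed.

Theorem theorem1p2 (F : fieldType) (n : nat) (A : 'M[F]_n) (lam mu : int -> F) :
  (1 <= n)%N ->
  lambda_det_defined A lam mu ->
  lambda_det A lam mu =
    \sum_(B : 'M[sign_entry]_n | is_asm B)
      \prod_(i < n) \prod_(j < n) weight A lam mu B i j.
Proof.
case: n A => // L A _ dA.
rewrite (lambda_det_heights dA erefl) (sum_asm_heights (leqnn L.+1)).
apply: eq_bigr => g ag; apply: eq_bigr => i _; apply: eq_bigr => j _.
have [t ht] := cell_type ag (ltn_ord i) (ltn_ord j).
rewrite (below_sumE ag (ltn_ord i) (ltn_ord j) (leqnn _) _ _ _ ht) cone_value1.
rewrite /weight (vertex_matrix_of_height ag ht) [LHS]mulrC.
congr (_ ^ _ * _).
  by rewrite -matrix_of_heightE // /bval !inord_val.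
have -> : mu (i.+1%:Z + j.+1%:Z - L.+1%:Z - 1) = mcoef mu L i j.
  by rewrite /mcoef; congr mu; lia.
(* In type c2 the corner products are 1, so the sum of the two parameters remains. *)
by case: t {ht} => //; rewrite !mulr1 addrC.
Qed.
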